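(* Let $k\geq 1$ be an integer. The sphere $S^{2k-1}$ can be covered by $2k+2$ open sets, none of which contains a pair of antipodal points, such that every point of $S^{2k-1}$ is contained in at most $k+1$ of these sets. The sphere $S^{2k}$ can be covered by $2k+3$ open sets, none of which contains a pair of antipodal points, such that every point of $S^{2k}$ is contained in at most $k+2$ of these sets. *)

(* Defs.v *)
From HB Require Import structures.
From mathcomp Require Import all_boot all_order all_algebra.
From mathcomp Require Import all_classical all_reals all_analysis.

Set Implicit Arguments.
Unset Strict Implicit.
Unset Printing Implicit Defensive.

Import numFieldNormedType.Exports.
Local Open Scope classical_set_scope.
Local Open Scope ring_scope.

(* The library's norm on row vectors is the sup norm, hence the explicit
   Euclidean equation. *)
Definition sphere (R : realType) (d : nat) : set 'rV[R]_d.+1 :=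
  [set x | \sum_i x ord0 i ^+ 2 = 1].
Arguments sphere : clear implicits.

(* Subsets of the sphere are sets of vectors included in [sphere R d].
   The type [subspace (sphere R d)] carries the relative topology, in which
   the points off the sphere are isolated, so that the inclusion in the sphere
   has to be stated separately. *)
Definition open_in_sphere (R : realType) (d : nat) (A : set 'rV[R]_d.+1) :=
  A `<=` sphere R d /\ open (A : set (subspace (sphere R d))).

Definition contains_antipodal_pair (R : realType) (d : nat)
    (A : set 'rV[R]_d.+1) :=
  exists2 x, sphere R d x & A x /\ A (- x).

(* The injectivity of [A] says that there are exactly [n] sets, so that counting
   indices is the same as counting sets. *)
Definition antipodal_free_cover (R : realType) (d n m : nat)
    (A : 'I_n -> set 'rV[R]_d.+1) :=
  [/\ injective A,
      forall i, open_in_sphere (A i),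
      sphere R d = \bigcup_i A i,
      forall i, ~ contains_antipodal_pair (A i) &
      forall x, sphere R d x -> (#|[pred i | x \in A i]| <= m)%N].

(* Main.v *)
Require Import Defs.
From HB Require Import structures.
From mathcomp Require Import all_boot all_order all_algebra.
From mathcomp Require Import all_classical all_reals all_analysis.

(* The linear map x |-> (x, - sum x) identifies S^d with the directions of the
   sum-zero hyperplane of R^(d+2). Fix r with d + 2 < 2r. The d + 3 sets are
   B_j = {the j-th coordinate is positive and larger than the r-th largest one}
   and B = {at least r coordinates are positive}. A point lies in at most r - 1
   of the B_j; if it is not in B, its largest coordinate j puts it in B_j; and
   B contains no antipodal pair, since this would need 2r coordinates. *)

Set Implicit Arguments.
Unset Strict Implicit.
Unset Printing Implicit Defensive.

Import Order.TTheory GRing.Theory Num.Theory.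
Import numFieldNormedType.Exports.
Local Open Scope classical_set_scope.
Local Open Scope ring_scope.

(** Finitely many neighbourhoods intersect in a neighbourhood; this keeps all strict inequalities
    that hold at a point valid near it. *)
Lemma near_forall_imply (T : Type) (F : set_system T) {FF : Filter F}
    (I : finType) (P : I -> Prop) (Q : I -> set T) :
  (forall i, P i -> \forall y \near F, Q i y) ->
  \forall y \near F, forall i, P i -> Q i y.
Proof.
move=> PQ; apply: filter_forall => i; have [Pi|nPi] := pselect (P i).
  by apply: filterS (PQ i Pi).
exact: filterE.
Qed.

Section Cover.
Variables (R : realType) (d : nat).
Implicit Types (x : 'rV[R]_d.+1) (j l : option 'I_d.+1).

Definition zero_sum_coord x j : R :=
  if j is Some i then x ord0 i else - \sum_i x ord0 i.

Lemma zero_sum_coordZ c x j :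
  zero_sum_coord (c *: x) j = c * zero_sum_coord x j.
Proof.
case: j => [i|] /=; first by rewrite mxE.
by rewrite mulrN mulr_sumr; congr (- _); apply: eq_bigr => i _; rewrite mxE.
Qed.

Lemma zero_sum_coordN x j : zero_sum_coord (- x) j = - zero_sum_coord x j.
Proof. by rewrite -scaleN1r zero_sum_coordZ mulN1r. Qed.

Lemma sum_zero_sum_coord x : \sum_j zero_sum_coord x j = 0.
Proof.
rewrite (bigD1 None) //= (reindex_omap (op := +%R) Some id) /=; last by case.
by under [X in _ + X]eq_bigl do rewrite eqxx; rewrite addNr.
Qed.

Lemma zero_sum_coord_continuous j :
  continuous (fun x => zero_sum_coord x j).
Proof.
case: j => [i|] x; first exact: coord_continuous.
have sum_continuous : continuous (fun x : 'rV[R]_d.+1 => \sum_i x ord0 i : R^o).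
  apply: continuous_big => [|i _]; first exact: add_continuous.
  exact: coord_continuous.
exact: cvgN (sum_continuous x).
Qed.

Lemma sphere_neq0 x : sphere R d x -> x != 0.
Proof.
move=> sx; apply/eqP => x0; move: sx; rewrite /sphere /= x0 big1 => [/eqP|i _].
  by rewrite eq_sym oner_eq0.
by rewrite mxE expr0n.
Qed.

(** Otherwise the negated coordinates are nonnegative with sum 0, so all vanish, and [x] with
    them. *)
Lemma zero_sum_coord_gt0 x : x != 0 -> exists j, 0 < zero_sum_coord x j.
Proof.
move=> x0; apply: contrapT => npos.
have le0 j : 0 <= - zero_sum_coord x j.
  by rewrite oppr_ge0 leNgt; apply/negP => ?; apply: npos; exists j.
have /eqP : \sum_j - zero_sum_coord x j = 0.
  by rewrite sumrN sum_zero_sum_coord oppr0.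
rewrite psumr_eq0 // => /allP fx0; case/negP: x0; apply/eqP/rowP => i.
have := fx0 (Some i) (mem_index_enum _).
by rewrite /= oppr_eq0 => /eqP ->; rewrite mxE.
Qed.

Lemma sphere_rescale x :
  x != 0 -> exists2 c : R, 0 < c & sphere R d (c *: x).
Proof.
move=> x0; set s := \sum_i x ord0 i ^+ 2.
have s0 : 0 < s.
  rewrite lt_def sumr_ge0 ?andbT => [|i _]; last exact: sqr_ge0.
  apply: contra x0; rewrite psumr_eq0 => [/allP h|i _]; last exact: sqr_ge0.
  apply/eqP/rowP => i; have := h i (mem_index_enum _).
  by rewrite /= sqrf_eq0 mxE => /eqP.
exists (Num.sqrt s)^-1; first by rewrite invr_gt0 sqrtr_gt0.
rewrite /sphere /=.
under eq_bigr do rewrite mxE exprMn.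
by rewrite -mulr_sumr exprVn sqr_sqrtr ?ltW// mulVf// gt_eqF.
Qed.

(** These points serve to tell the cover sets apart. *)
Lemma sphere_single_positive j : exists2 x, sphere R d x &
  0 < zero_sum_coord x j /\ forall l, l != j -> zero_sum_coord x l < 0.
Proof.
(* The value d + 1 at [j] balances the -1 at each of the d + 1 other indices, so [vE] holds at
   [None] too. *)
pose v : 'rV[R]_d.+1 := \row_i (if Some i == j then d.+1%:R else -1).
have vE l : zero_sum_coord v l = if l == j then d.+1%:R else -1.
  case: l => [i|] /=; first by rewrite mxE.
  under eq_bigr do rewrite mxE.
  case: j {v} => [m|] /=; last by rewrite sumr_const card_ord mulNrn opprK.
  rewrite (bigD1 m) //= eqxx (eq_bigr (fun=> -1)) => [|i /negPf im].
    rewrite sumr_const cardC1 card_ord /= mulNrn -natr1.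
    by rewrite addrAC subrr add0r.
  by rewrite (inj_eq Some_inj) im.
have v0 : v != 0.
  apply/eqP => v0; have := vE j; rewrite v0 eqxx -(scale0r 0).
  by rewrite zero_sum_coordZ mul0r => /esym/eqP; rewrite pnatr_eq0.
have [c c0 sc] := sphere_rescale v0.
exists (c *: v) => //; split => [|l lj]; rewrite zero_sum_coordZ vE.
  by rewrite eqxx mulr_gt0// ltr0n.
by rewrite (negPf lj) mulrN1 oppr_lt0.
Qed.

Variable r : nat.

(** The outer [None] gives B and [Some j] gives B_j. Comparison with the r-th largest coordinate is
    done by counting, which avoids sorting; the count includes [j] itself and all ties. *)
Definition cover_set (o : option (option 'I_d.+1)) : set 'rV[R]_d.+1 :=
  if o is Some j then
    [set x | 0 < zero_sum_coord x j
      /\ (#|[pred l | (zero_sum_coord x j <= zero_sum_coord x l)%R]| < r)%N]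
  else [set x | (r <= #|[pred l | (0 < zero_sum_coord x l)%R]|)%N].

Lemma near_zero_sum_coord_lt x j l : zero_sum_coord x j < zero_sum_coord x l ->
  \forall y \near x, zero_sum_coord y j < zero_sum_coord y l.
Proof.
rewrite -subr_gt0 => jl; near=> y; rewrite -subr_gt0; near: y.
exact: (cvgr_gt _ (cvgB (@zero_sum_coord_continuous l x)
  (@zero_sum_coord_continuous j x))).
Unshelve. all: by end_near. Qed.

Lemma near_zero_sum_coord_gt0 x j : 0 < zero_sum_coord x j ->
  \forall y \near x, 0 < zero_sum_coord y j.
Proof. by move=> j0; exact: (cvgr_gt _ (@zero_sum_coord_continuous j x)). Qed.

(** Strict inequalities persist nearby: the set of indices counted for B_j can only shrink, and the
    one counted for B can only grow. *)
Lemma open_cover_set o : open (cover_set o).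
Proof.
rewrite openE => x; case: o => [j [j0 xr]|/= xr]; rewrite /interior.
- have near_lt :=
    near_forall_imply (FF := nbhs_filter x) (@near_zero_sum_coord_lt x ^~ j).
  apply: filterS2 (near_zero_sum_coord_gt0 j0) near_lt => y y0 xy.
  split => //; apply: leq_ltn_trans xr.
  apply/subset_leq_card/fintype.subsetP => l.
  by rewrite !inE !leNgt; apply: contra => /xy.
- have := near_forall_imply (FF := nbhs_filter x) (@near_zero_sum_coord_gt0 x).
  apply: filterS => y xy.
  apply: (leq_trans xr); apply/subset_leq_card/fintype.subsetP => l.
  by rewrite !inE => /xy.
Qed.

Lemma cover_set_covers x : x != 0 -> exists o, cover_set o x.
Proof.
move=> /zero_sum_coord_gt0[j j0].
have [xr|xr] := leqP r #|[pred l | 0 < zero_sum_coord x l]|; first by exists None.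
(* Any positive coordinate [j] will do: the coordinates that are at least as large are positive too,
   hence fewer than [r]. *)
exists (Some j); split => //.
apply: leq_ltn_trans xr; apply/subset_leq_card/fintype.subsetP => l.
by rewrite !inE; exact: lt_le_trans.
Qed.

Lemma cover_set_antipodal_free o x :
  (d.+2 < 2 * r)%N -> cover_set o x -> ~ cover_set o (- x).
Proof.
move=> dr; case: o => [j [j0 _] [] | /= xr nxr].
  by rewrite zero_sum_coordN oppr_gt0 => /(lt_trans j0); rewrite ltxx.
move: dr; apply/negP; rewrite -leqNgt mul2n -addnn.
apply: leq_trans (leq_add xr nxr) _.
(* The indices positive at [x] and those positive at [- x] are disjoint, so together they number at
   most d + 2. *)
rewrite -cardUI [X in (_ + X)%N]eq_card0 => [|l].
  by rewrite addn0 (leq_trans (max_card _))// card_option card_ord.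
rewrite !inE zero_sum_coordN oppr_gt0; apply/negP => /andP[l0 /(lt_trans l0)].
by rewrite ltxx.
Qed.

(** Among the [j] with [x] in B_j, take one with the smallest coordinate: all the others are counted
    in the bound that defines its B_j. *)
Lemma card_cover_set_Some x : (0 < r)%N ->
  (#|[pred j | x \in cover_set (Some j)]| < r)%N.
Proof.
move=> r0; have [j0 j0P|/eq_card0 ->//] := pickP [pred j | x \in cover_set (Some j)].
case: (@arg_minP _ _ _ j0 [pred j | x \in cover_set (Some j)]
  (zero_sum_coord x) j0P) => j; rewrite !inE => -[_ xr] jmin.
apply: leq_ltn_trans xr; apply/subset_leq_card/fintype.subsetP => l.
by move/jmin; rewrite inE.
Qed.

Lemma card_cover_set x : (0 < r)%N ->
  (#|[pred o | x \in cover_set o]| <= r)%N.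
Proof.
move=> /(card_cover_set_Some x); apply: leq_trans.
rewrite (cardD1 None) -[leqRHS]add1n leq_add ?leq_b1//.
rewrite -[leqRHS](fintype.card_image Some_inj); apply/subset_leq_card/fintype.subsetP => -[j|]//.
by rewrite !inE /= => jx; apply/fintype.imageP; exists j; rewrite ?inE.
Qed.

(** At the point whose only positive coordinate is [j], all the counts are at most 1 < [r], so it
    lies in B_j and in no other set. This gives injectivity of the cover. *)
Lemma cover_set_separates o o' : (1 < r)%N -> o != o' ->
  exists2 x, sphere R d x & cover_set o x /\ ~ cover_set o' x
                          \/ cover_set o' x /\ ~ cover_set o x.
Proof.
move=> r1.
(* Two distinct indices cannot both be [None], and the claim is symmetric. *)
wlog [j ->] : o o' / exists j, o = Some j => [hw|].
  case: o => [j oo'|]; first by apply: hw => //; exists j.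
  case: o' => // j _; have [||x sx []] := hw (Some j) None; rewrite //.
  - by exists j.
  - by exists x => //; right.
  - by exists x => //; left.
have [x sx [xj xl]] := sphere_single_positive j.
have pos l : 0 < zero_sum_coord x l -> l = j.
  by move=> l0; apply/eqP; apply: contraTT l0 => /xl; rewrite -leNgt; exact: ltW.
have cardj (P : pred (option 'I_d.+1)) :
    (forall l, P l -> 0 < zero_sum_coord x l) -> (#|P| < r)%N.
  move=> Ppos; apply: leq_ltn_trans r1; rewrite -(card1 j).
  by apply/subset_leq_card/fintype.subsetP => l /Ppos/pos ->; rewrite inE.
move=> jo'; exists x => //; left; split.
  by split => //; apply: cardj => l /=; exact: lt_le_trans.
case: o' jo' => [l jl [l0 _]|_ /=].
  by move: jl; rewrite (pos _ l0) eqxx.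
by apply/negP; rewrite -ltnNge; apply: cardj.
Qed.

End Cover.

(** The equation on [n] lets the index types of the theorem be used without a cast. *)
Lemma sphere_antipodal_free_cover (R : realType) (d n r : nat) :
  n = d.+3 -> (1 < r)%N -> (d.+2 < 2 * r)%N ->
  exists A : 'I_n -> set 'rV[R]_d.+1, antipodal_free_cover r A.
Proof.
move=> nd r1 dr.
have e : n = #|{: option (option 'I_d.+1)}| by rewrite !card_option card_ord.
pose g := (@enum_val (option (option 'I_d.+1)) predT) \o cast_ord e.
pose h (o : option (option 'I_d.+1)) : 'I_n := cast_ord (esym e) (enum_rank o).
have gK : cancel g h by move=> i; rewrite /h /= enum_valK cast_ordK.
have hK : cancel h g by move=> o; rewrite /g /h /= cast_ordKV enum_rankK.
exists (fun i => sphere R d `&` cover_set r (g i)); split.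
- move=> i i' eqA; apply: (can_inj gK); apply/eqP/negPn/negP.
  move=> /(cover_set_separates R r1)[x sx [[gx ngx]|[gx ngx]]].
    by have [] : (sphere R d `&` cover_set r (g i')) x by rewrite -eqA.
  by have [] : (sphere R d `&` cover_set r (g i)) x by rewrite eqA.
- move=> i; split; first exact: subIsetl.
  (* Intersecting with the sphere does not affect relative openness, so openness in the ambient
     space suffices. *)
  rewrite open_subspaceTI; exact/open_subspaceW/open_cover_set.
- apply/seteqP; split => x; last by case=> i _ [].
  move=> sx; have [i xi] := cover_set_covers r (sphere_neq0 sx).
  by exists (h i) => //; rewrite hK.
- move=> i [x _ [[_ xi] [_]]]; exact: cover_set_antipodal_free xi.
- move=> x sx; apply: leq_trans (card_cover_set x (ltnW r1)).
  rewrite -[leqLHS](fintype.card_image (can_inj gK)).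
  apply/subset_leq_card/fintype.subsetP => o /fintype.imageP[i + ->].
  by rewrite !inE => -[].
Qed.

Theorem theorem4p2 (R : realType) (k : nat) (hk : (1 <= k)%N) :
  (exists A : 'I_(2 * k + 2) -> set 'rV[R]_(2 * k - 1).+1,
     antipodal_free_cover (k + 1) A) /\
  (exists A : 'I_(2 * k + 3) -> set 'rV[R]_(2 * k).+1,
     antipodal_free_cover (k + 2) A).
Proof.
(* In both cases [r] is the least integer with d + 2 < 2r: 2k + 1 < 2(k + 1) for d = 2k - 1, and 2k
   + 2 < 2(k + 2) for d = 2k. The bound [hk] makes the truncated [2 * k - 1] a true difference. *)
split; apply: sphere_antipodal_free_cover.
- by rewrite -subSn ?muln_gt0// subn1 addn2.
- by rewrite addn1.
- by rewrite -subSn ?muln_gt0// subn1 mulnDr addn2.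
- by rewrite addn3.
- by rewrite addn2.
- by rewrite mulnDr !mulnS -addn2 ltn_add2l.
Qed.
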